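(* Let $\widetilde H$ be the approximate Hamiltonian obtained from the least squares problem described in the context, and let $\widetilde{\mathbf u}(t;\mathbf u_0)$ be the solution of the reconstructed system $$\frac{d\mathbf u}{dt}=\mathbf J^{-1}\nabla\widetilde H(\mathbf u)$$ with initial state $\mathbf u_0$ at $t=0$. Then $$\widetilde H\big(\widetilde{\mathbf u}(t;\mathbf u_0)\big)=\widetilde H(\mathbf u_0)\qquad\text{for all } t\ge 0 \text{ and all } \mathbf u_0 .$$
   Context: Let $d\ge1$, $D\subset\mathbb R^{2d}$ a domain, and $\mathbf J=\begin{pmatrix}\mathbf 0_d&\mathbf I_d\\-\mathbf I_d&\mathbf 0_d\end{pmatrix}\in\mathbb R^{2d\times 2d}$, where $\mathbf I_d,\mathbf 0_d$ are the $d\times d$ identity and zero matrices. Let $\omega$ be a probability measure on $D$ and $\mathbb W$ a finite-dimensional subspace of the weighted Sobolev space $\mathbb H^1_\omega(D)$ with inner product $(g,h)=\int_D(gh+\nabla g\cdot\nabla h)\,d\omega$. The functions in $\mathbb W$ are continuously differentiable. Put $\mathbb V=\{\nabla h:h\in\mathbb W\}$, $N=\dim\mathbb V\ge1$. Given data pairs $(\mathbf x_k,\dot{\mathbf x}_k)$, $k=1,\dots,K$, with $N<K$ (states $\mathbf x_k\in D$ and time-derivative data $\dot{\mathbf x}_k\in\mathbb R^{2d}$), $\nabla\widetilde H\in\mathbb V$ is a minimizer of $\sum_{k=1}^K\|\mathbf J\dot{\mathbf x}_k-\nabla h(\mathbf x_k)\|_2^2$ over $\nabla h\in\mathbb V$.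 The function $\widetilde H$ is any function with this gradient of the form $\widetilde H=C+\sum_{j=1}^N c_j\phi_j$, where $C\in\mathbb R$ is an arbitrary constant, $\phi_j\in\mathbb W$, $\{\nabla\phi_j\}_{j=1}^N$ is a basis of $\mathbb V$, and $\nabla\widetilde H=\sum_j c_j\nabla\phi_j$. Initial states and solutions are understood to lie in the domain where $\widetilde H$ is defined, and $t$ ranges over the times at which the solution exists. *)

(* Defs.v *)
From HB Require Import structures.
From mathcomp Require Import all_boot all_order all_algebra.
From mathcomp Require Import all_classical all_reals all_analysis.

Set Implicit Arguments.
Unset Strict Implicit.
Unset Printing Implicit Defensive.

Import Order.TTheory GRing.Theory Num.Theory.
Import numFieldNormedType.Exports.

Local Open Scope classical_set_scope.
Local Open Scope ring_scope.

Definition domain (T : topologicalType) (D : set T) : Prop :=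
  [/\ open D, connected D & D !=set0].

(* Functions on D are represented by total functions whose values outside D are
   irrelevant: identities between them are only required to hold on D. *)
Section FunctionSpaces.
Variables (R : nzRingType) (T : Type) (E : lmodType R).
Implicit Types (D : set T) (S : set (T -> E)).

Definition linear_subspace S : Prop :=
  S (fun=> 0) /\
  forall (a : R) (f g : T -> E), S f -> S g -> S (fun x => a *: f x + g x).

Definition basis_on D S n (e : 'I_n -> T -> E) : Prop :=
  [/\ forall j, S (e j),
      forall c : 'I_n -> R,
        {in D, (fun x => \sum_(j < n) c j *: e j x) =1 (fun=> 0)} ->
        forall j, c j = 0
    & forall f, S f -> exists c : 'I_n -> R,
        {in D, f =1 (fun x => \sum_(j < n) c j *: e j x)}].

Definition dim_on D S n : Prop := exists e : 'I_n -> T -> E, basis_on D S e.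

End FunctionSpaces.

Section EuclideanCalculus.
Variables (R : realType) (n : nat).
Implicit Types (v w x : 'cV[R]_n) (g h : 'cV[R]_n -> R) (D : set 'cV[R]_n).

Definition dotv v w : R := \sum_(i < n) v i 0 * w i 0.

(* The norm `|v| that MathComp-Analysis puts on matrices is the sup norm. *)
Definition norm2 v : R := Num.sqrt (dotv v v).

Definition grad h x : 'cV[R]_n := \col_(i < n) 'D_(delta_mx i 0) h x.

Definition continuously_differentiable_on D h : Prop :=
  {in D, forall x, differentiable h x} /\ {in D, continuous (grad h)}.

Definition borel_space := g_sigma_algebraType (@open 'cV[R]_n).

Definition H1_inner D (omega : probability borel_space R) g h : \bar R :=
  (\int[omega]_(x in D) (g x * h x + dotv (grad g x) (grad h x))%:E)%E.

(* Only the continuously differentiable elements of the weighted Sobolev space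
   are needed, and for these the gradient is the classical one. *)
Definition H1_C1 D (omega : probability borel_space R) : set ('cV[R]_n -> R) :=
  [set h | continuously_differentiable_on D h /\
           (H1_inner D omega h h < +oo)%E].

(* The derivative is relative to I, hence one-sided at an end point of I. *)
Definition solves_ode D (F : 'cV[R]_n -> 'cV[R]_n) (I : set R)
    (u : R -> 'cV[R]_n) : Prop :=
  forall t, I t -> D (u t) /\
    (s - t)^-1 *: (u s - u t) @[s --> within I t^'] --> F (u t).

End EuclideanCalculus.

Section HamiltonianReconstruction.
Variables (R : realType) (d : nat).
Let space := 'cV[R]_(d + d).
Implicit Types (D : set space) (W : set (space -> R)) (G : space -> space).

Definition symplectic_mx : 'M[R]_(d + d) := block_mx 0 1%:M (- 1%:M) 0.

Definition gradients W : set (space -> space) := [set grad h | h in W].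

Definition least_squares_loss K (x xdot : 'I_K -> space) G : R :=
  \sum_(k < K) norm2 (symplectic_mx *m xdot k - G (x k)) ^+ 2.

Definition least_squares_minimizer W K (x xdot : 'I_K -> space) G : Prop :=
  gradients W G /\
  forall G', gradients W G' ->
    least_squares_loss x xdot G <= least_squares_loss x xdot G'.

(* As D is open and the phi j are differentiable on D, the last two clauses
   entail that grad H agrees with G on D. *)
Definition approximate_hamiltonian D W N G (H : space -> R) : Prop :=
  exists (phi : 'I_N -> space -> R) (C : R) (c : 'I_N -> R),
    [/\ forall j, W (phi j),
        basis_on D (gradients W) (fun j => grad (phi j)),
        {in D, G =1 (fun y => \sum_(j < N) c j *: grad (phi j) y)}
      & {in D, H =1 (fun y => C + \sum_(j < N) c j * phi j y)}].

Definition reconstructed_field (H : space -> R) (y : space) : space :=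
  invmx symplectic_mx *m grad H y.

End HamiltonianReconstruction.

(* Main.v *)
(** [H] is conserved because [J^-1] is skew-symmetric: along a solution the
    derivative of [H \o u] is [(grad H)^T J^-1 grad H = 0], and the mean value
    theorem applies on every segment of times. *)
Require Import Defs.
From mathcomp Require Import all_boot all_order all_algebra.
From mathcomp Require Import all_classical all_reals all_analysis.

Import Order.TTheory GRing.Theory Num.Theory.
Import numFieldNormedType.Exports.

Local Open Scope classical_set_scope.
Local Open Scope ring_scope.

Lemma symplectic_mxK (R : realType) (d : nat) :
  symplectic_mx R d *m symplectic_mx R d = - 1%:M.
Proof.
rewrite /symplectic_mx mulmx_block !(mul0mx, mulmx0, mul1mx, mulmx1).
by rewrite !(addr0, add0r) [in RHS]scalar_mx_block opp_block_mx oppr0.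
Qed.

Lemma invmx_symplectic_mx (R : realType) (d : nat) :
  invmx (symplectic_mx R d) = - symplectic_mx R d.
Proof.
have JV : - symplectic_mx R d *m symplectic_mx R d = 1%:M.
  by rewrite mulNmx symplectic_mxK opprK.
have [_ Ju] := mulmx1_unit JV.
by rewrite -[RHS](mulmxK Ju) JV mul1mx.
Qed.

Lemma trmx_symplectic_mx (R : realType) (d : nat) :
  (symplectic_mx R d)^T = - symplectic_mx R d.
Proof.
by rewrite /symplectic_mx tr_block_mx opp_block_mx !linearN /= !trmx0 trmx1
   oppr0 opprK.
Qed.

Lemma dotvE (R : realType) (n : nat) (v w : 'cV[R]_n) :
  dotv v w = (v^T *m w) 0 0.
Proof. by rewrite mxE; apply: eq_bigr => i _; rewrite mxE. Qed.

(** The inverse of the symplectic matrix is its negative, hence skew-symmetric, and the quadratic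
    form of a skew-symmetric matrix vanishes: as a 1 by 1 matrix it equals its transpose, which is
    also its opposite. *)
Lemma dotv_symplectic (R : realType) (d : nat) (v : 'cV[R]_(d + d)) :
  dotv v (invmx (symplectic_mx R d) *m v) = 0.
Proof.
rewrite invmx_symplectic_mx mulNmx dotvE.
set a := _ *m _; have aN : a^T = - a.
  rewrite /a mulmxN linearN /= !trmx_mul trmxK trmx_symplectic_mx.
  by rewrite mulmxN mulNmx mulmxA.
by move/matrixP/(_ 0 0)/eqP: aN; rewrite !mxE -subr_eq0 opprK -mulr2n
  mulrn_eq0 /= => /eqP.
Qed.

Lemma derive_grad (R : realType) (n : nat) (h : 'cV[R]_n -> R) (x v : 'cV[R]_n) :
  differentiable h x -> 'D_v h x = dotv (grad h x) v.
Proof.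
move=> dh; rewrite deriveE// [in LHS](matrix_sum_delta v) linear_sum /=.
apply: eq_bigr => i _; rewrite big_ord1 linearZ /= mxE deriveE//.
by rewrite mulrC.
Qed.

(** Partial derivatives depend only on the germ at [x], and openness turns equality on [D] into
    equality near each of its points. *)
Lemma eq_in_grad (R : realType) (n : nat) (D : set 'cV[R]_n)
    (g h : 'cV[R]_n -> R) :
  open D -> {in D, g =1 h} -> {in D, grad g =1 grad h}.
Proof.
move=> oD gh x /set_mem Dx; apply/colP => i; rewrite !mxE.
apply: near_eq_derive; near=> y; apply/gh/mem_set; near: y.
exact: open_nbhs_nbhs.
Unshelve. all: by end_near. Qed.

Lemma differentiable_linear_combination (R : realType) (V : normedModType R)
    (n : nat) (f : 'I_n -> V -> R) (C : R) (c : 'I_n -> R) (x : V) :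
  (forall j, differentiable (f j) x) ->
  differentiable (fun y => C + \sum_(j < n) c j * f j y) x.
Proof.
move=> df.
rewrite (_ : (fun y => _) = cst C + \sum_(j < n) c j *: f j); last first.
  by apply/funext => y; rewrite fctE fct_sumE.
apply: differentiableD => //; apply: differentiable_sum => j.
exact: differentiableZ.
Qed.

Section DifferenceQuotient.
Variables (R : realType) (V : normedModType R).
Implicit Types (u : R -> V) (I : set R).

(** Write [u s] as [u t] plus [s - t] times the quotient, which tends to [u t + 0 *: l]. This also
    covers end points of [I], where the derivative is only one-sided. *)
Lemma cvg_quotient_within_continuous I u (t : R) (l : V) :
  (s - t)^-1 *: (u s - u t) @[s --> within I t^'] --> l ->
  u @ within I (nbhs t) --> u t.
Proof.
move=> ul.
have st0 : s - t @[s --> within I t^'] --> (0 : R).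
  rewrite -(subrr t); apply: cvgB; last exact: cvg_cst.
  by apply: cvg_within_filter; exact: nbhs_dnbhs.
have uc : u t + (s - t) *: ((s - t)^-1 *: (u s - u t))
    @[s --> within I t^'] --> u t.
  rewrite -[X in _ --> X]addr0 -(scale0r l).
  by apply: cvgD; [exact: cvg_cst|exact: cvgZ].
move=> A At; have := uc A At.
rewrite /= !near_simpl !near_withinE => Au.
(* The punctured filter says nothing about [s = t], where the claim is trivial. *)
near=> s => Is; have [->|st] := eqVneq s t; first exact: nbhs_singleton.
have := near Au s _ st Is.
rewrite scalerA divff ?subr_eq0// scale1r addrC subrK; exact.
Unshelve. all: by end_near. Qed.

(** At an interior point of [I] the restriction to [I] is no constraint near [t], and the
    substitution [s = t + r] yields the usual two-sided derivative. *)
Lemma cvg_quotient_is_derive I u (t : R) (l : V) : nbhs t I ->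
  (s - t)^-1 *: (u s - u t) @[s --> within I t^'] --> l ->
  is_derive t 1 u l.
Proof.
move=> tI ul.
have ul' : h^-1 *: ((u \o shift t) h%:A - u t) @[h --> 0^'] --> l.
  move=> A Al; have := ul A Al; rewrite /= !near_simpl !near_withinE.
  move=> /(nbhs0P (V := R^o)) Au.
  near=> r => r0.
  have Pr : t + r != t -> I (t + r) -> A ((t + r - t)^-1 *: (u (t + r) - u t)).
    by near: r; exact: Au.
  have Ir : I (t + r).
    by near: r; exact: ((nbhs0P (V := R^o) I t).1 tI).
  move: Pr; rewrite [t + r - t]addrC addKr /= [_%:A]mulr1 [r + t]addrC; apply=> //.
  by rewrite -subr_eq0 [t + r]addrC addrK.
by apply: DeriveDef; [apply/cvg_ex; exists l|exact: cvg_lim].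
Unshelve. all: by end_near. Qed.

End DifferenceQuotient.

Lemma first_integral_of_grad_orthogonal (R : realType) (n : nat)
    (D : set 'cV[R]_n) (F : 'cV[R]_n -> 'cV[R]_n) (h : 'cV[R]_n -> R)
    (I : set R) (u : R -> 'cV[R]_n) :
  {in D, forall y, differentiable h y} ->
  {in D, forall y, dotv (grad h y) (F y) = 0} ->
  is_interval I -> solves_ode D F I u ->
  forall s t, I s -> I t -> s <= t -> h (u t) = h (u s).
Proof.
move=> dh hF itvI sol s t Is It st.
have sub_I r : r \in `[s, t]%R -> I r.
  by rewrite in_itv /= => /(itvI s t Is It).
(* Every point of the open segment is interior to [I], so the chain rule gives the derivative
   [dotv (grad h (u r)) (F (u r))], which is zero by orthogonality. *)
have hu_deriv r : r \in `]s, t[%R -> is_derive r 1 (h \o u) 0.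
  move=> rst.
  have /sub_I/sol[Dur ur] : r \in `[s, t]%R by exact: subset_itv_oo_cc rst.
  have /cvg_quotient_is_derive/(_ ur) dur : nbhs r I.
    have : nbhs r `]s, t[%classic by apply: open_nbhs_nbhs; split.
    by apply: filterS => q /= /subset_itv_oo_cc/sub_I.
  have /derivable1_diffP du : derivable u r 1 by [].
  have dhu := dh _ (mem_set Dur).
  apply: DeriveDef; first exact/derivable1_diffP/differentiable_comp.
  rewrite deriveE; last exact: differentiable_comp.
  rewrite diff_comp //= -[X in 'd h _ X]deriveE // (@derive_val _ _ _ _ _ _ _ dur).
  by rewrite -deriveE // derive_grad // hF //; exact/mem_set.
(* At [s] and [t], which may be end points of [I], the mean value theorem asks only for continuity
   relative to the segment. *)
have hu_cont : {within `[s, t], continuous (h \o u)}.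
  apply: (continuous_subspaceW sub_I); apply/subspace_continuousP => r Ir.
  have [Dur /cvg_quotient_within_continuous ur] := sol r Ir.
  apply: continuous_cvg => //.
  exact/differentiable_continuous/dh/mem_set.
have [c _] := MVT_segment st hu_deriv hu_cont.
by rewrite mul0r => /eqP; rewrite subr_eq0 => /eqP.
Qed.

Theorem theorem3p1 (R : realType) (d : nat) (d_gt0 : (0 < d)%N)
    (D : set 'cV[R]_(d + d)) (domD : domain D)
    (omega : probability (borel_space R (d + d)) R) (omegaD : omega D = 1%E)
    (W : set ('cV[R]_(d + d) -> R)) (W_subspace : linear_subspace W)
    (W_H1 : W `<=` H1_C1 D omega) (W_findim : exists m, dim_on D W m)
    (N K : nat) (dimV : dim_on D (gradients W) N)
    (N_gt0 : (0 < N)%N) (ltNK : (N < K)%N)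
    (x xdot : 'I_K -> 'cV[R]_(d + d)) (xD : forall k, D (x k))
    (gradHt : 'cV[R]_(d + d) -> 'cV[R]_(d + d))
    (gradHt_min : least_squares_minimizer W x xdot gradHt)
    (Ht : 'cV[R]_(d + d) -> R)
    (HtE : approximate_hamiltonian D W N gradHt Ht)
    (u0 : 'cV[R]_(d + d)) (u0D : D u0)
    (I : set R) (I_itv : is_interval I) (I0 : I 0)
    (u : R -> 'cV[R]_(d + d)) (u_init : u 0 = u0)
    (u_sol : solves_ode D (reconstructed_field Ht) I u) :
  forall t, I t -> 0 <= t -> Ht (u t) = Ht u0.
Proof.
move=> t It t_ge0; have [oD _ _] := domD.
have [phi [C [c [phiW _ _ HtE_D]]]] := HtE.
(* The explicit combination inherits differentiability from the [phi j]; [Ht] is known only through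
   its agreement with it on [D]. *)
pose h y := C + \sum_(j < N) c j * phi j y.
have dh : {in D, forall y, differentiable h y}.
  move=> y Dy; apply: differentiable_linear_combination => j.
  by have [[dphi _] _] := W_H1 _ (phiW j); exact: dphi.
have hF : {in D, forall y, dotv (grad h y) (reconstructed_field Ht y) = 0}.
  (* The field is built from [grad Ht]; replacing it by [grad h] puts the same vector on both sides
     of the product. *)
  move=> y Dy; rewrite /reconstructed_field (eq_in_grad _ _ _ _ _ oD HtE_D _ Dy).
  exact: dotv_symplectic.
have [Dut _] := u_sol _ It; rewrite -u_init HtE_D ?HtE_D ?inE//; last first.
  by have [] := u_sol _ I0.
exact: (first_integral_of_grad_orthogonal _ _ _ _ _ _ _ dh hF I_itv u_sol _ _ I0 It).
Qed.
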